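(* Let $X$ be a countable regular $T_1$ space without isolated points whose topology is analytic. Then the game $G_{fin}$ on $X$ is determined. More precisely, letting $\mathfrak D(X)\subseteq 2^X$ be the collection of all dense subsets of $X$: (i) If $\mathfrak D(X)$ is a $G_\delta$ subset of $2^X$, then player II has a winning strategy for $G_{fin}$. (ii) If $\mathfrak D(X)$ is not a $G_\delta$ subset of $2^X$, then player I has a winning strategy for $G_{fin}$.
   Context: $2^X$ is the power set of the countable set $X$, identified via characteristic functions with the product of copies of the discrete space $\{0,1\}$, with the product topology. The topology $\tau$ of $X$ is analytic if $\tau$ is an analytic subset of $2^X$ (a continuous image of a Polish space). The game $G_{fin}$ on $X$: in round $n\in\mathbb N$, player I picks a dense subset $D_n$ of $X$ and then player II picks a finite set $a_n\subseteq D_n$. Player II wins the run if $\bigcup_n a_n$ is dense in $X$; otherwise player I wins. *)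

(* Defs.v *)
From HB Require Import structures.
From mathcomp Require Import all_boot all_order all_algebra.
From mathcomp Require Import all_classical all_reals all_analysis.
From mathcomp Require Import borel_hierarchy.

Set Implicit Arguments.
Unset Strict Implicit.
Unset Printing Implicit Defensive.

Local Open Scope classical_set_scope.

Section PolishAnalytic.

Definition separable_space (T : topologicalType) : Prop :=
  exists2 S : set T, countable S & dense S.

Definition complete_metric (R : realType) (M : metricType R) : Prop :=
  forall F : set_system M, ProperFilter F -> cauchy F -> exists l : M, F --> l.

Definition completely_metrizable (R : realType) (P : topologicalType) : Prop :=
  exists (M : metricType R) (h : P -> M) (g : M -> P),
    [/\ cancel h g, cancel g h, continuous h, continuous g & complete_metric M].

Definition polish_space (R : realType) (P : topologicalType) : Prop :=
  separable_space P /\ completely_metrizable R P.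

(* The empty set is analytic, as the image of the empty Polish space. *)
Definition analytic (R : realType) (T : topologicalType) (A : set T) : Prop :=
  exists (P : topologicalType) (f : P -> T),
    [/\ polish_space R P, continuous f & range f = A].

End PolishAnalytic.

(* The space 2^X is {ptws X -> bool}: the product over X of copies of bool, which
   carries the discrete topology. *)
Definition charfun (X : Type) (A : set X) : {ptws X -> bool} :=
  fun x => x \in A.

(* A family of subsets of X, seen as a subset of the space 2^X. *)
Definition in_pow2 (X : Type) (F : set_system X) : set {ptws X -> bool} :=
  [set charfun A | A in F].

Definition dense_sets (X : topologicalType) : set_system X :=
  [set D | dense D].
Arguments dense_sets X : clear implicits.

Section GameGfin.
Variable X : topologicalType.

(* a n is the move of player II in round n. *)
Definition II_wins_run (a : nat -> set X) : Prop := dense (\bigcup_n a n).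

(* sigma s is the move of player I after player II has played the moves s
   (the earlier moves of player I are determined by sigma). *)
Definition I_has_winning_strategy : Prop :=
  exists sigma : seq (set X) -> set X,
    (forall s, dense (sigma s)) /\
    forall a : nat -> set X,
      (forall n, finite_set (a n) /\ a n `<=` sigma (mkseq a n)) ->
      ~ II_wins_run a.

(* tau s D is the answer of player II to the move D of player I, when the moves
   of player I in the preceding rounds were s. *)
Definition II_has_winning_strategy : Prop :=
  exists tau : seq (set X) -> set X -> set X,
    (forall s D, dense D -> finite_set (tau s D) /\ tau s D `<=` D) /\
    forall D : nat -> set X,
      (forall n, dense (D n)) ->
      II_wins_run (fun n => tau (mkseq D n) (D n)).

Definition Gfin_determined : Prop :=
  I_has_winning_strategy \/ II_has_winning_strategy.

End GameGfin.

(* Main.v *)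
Require Import Defs.
From mathcomp Require Import all_boot all_order all_algebra.
From mathcomp Require Import all_classical all_reals all_analysis.
From mathcomp Require Import borel_hierarchy.
Import Order.TTheory Num.Theory.

(* If the dense sets form a G_delta set, the intersection of open sets G_n, then
   by compactness of 2^X every dense D has a finite subset a all of whose
   supersets lie in G_n; player II answers D_n by such an a_n.

   Otherwise player I secretly builds, along with the game, an open set missed by
   all the moves of player II (an unfolded game). Let f : P -> 2^X be continuous
   with range the topology.  For some point p, the sets missing an open
   neighbourhood of p are not separated from the dense sets by a G_delta set.
   Player I maintains a subset V_n of P such that the sets containing the moves
   played so far and missing some f y with y in V_n and p in f y are still not
   separated.  A Hurewicz-type argument (missing_step) shows that some dense D_n
   and some small cell of V_n preserve this whatever player II answers.  The cells
   shrink to a point whose image under f is the required open set. *)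

Local Open Scope classical_set_scope.

(** * Finite conditions and compactness in the power set *)

Section PowerSet.
Context {X : topologicalType}.
Implicit Types (F : set_system X) (b c : {ptws X -> bool}) (a D : set X).

Lemma in_pow2E F b : in_pow2 F b = F [set x | b x].
Proof.
apply/propext; split => [[A FA <-]|Fb].
  by rewrite /charfun (_ : [set x | x \in A] = A)//; apply/seteqP;
    split => x; rewrite /= inE.
exists [set x | b x] => //; apply/funext => x; rewrite /charfun.
by apply/idP/idP; rewrite inE.
Qed.

Lemma nbhs_coord b x : nbhs b [set c | c x = b x].
Proof. exact: (@proj_continuous X (fun=> bool) x b [set b x]). Qed.

Lemma open_supersets a : finite_set a ->
  open [set b : {ptws X -> bool} | forall x, a x -> b x].
Proof.
move=> fa; rewrite openE => b ab.
suff : nbhs b (\bigcap_(x in a) [set c | c x = b x]).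
  by apply: filterS => c bc x ax; rewrite (bc x ax) ab.
move: fa => /finite_fsetP[s ->].
by apply: filter_bigI => x _; exact: nbhs_coord.
Qed.

(** Compactness: otherwise the supersets of [a] outside [G], for finite [a] in [D], generate a
    proper filter. A cluster point of it contains [D], hence lies in the open set [G], a
    contradiction. *)
Lemma finite_part_in_open (G : set {ptws X -> bool}) D : open G ->
  (forall b, (forall x, D x -> b x) -> G b) ->
  exists a, [/\ finite_set a, a `<=` D & forall b, (forall x, a x -> b x) -> G b].
Proof.
move=> oG DG; apply: contrapT => noa.
pose I := [set a | finite_set a /\ a `<=` D].
pose B a := [set b : {ptws X -> bool} | (forall x, a x -> b x) /\ ~ G b].
have FB : ProperFilter (filter_from I B).
  apply: filter_from_proper.
    apply: filter_from_filter; first by exists set0; split.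
    move=> a a' [fa aD] [fa' aD']; exists (a `|` a').
      by split; [rewrite finite_setU | rewrite subUset].
    by move=> b [ab nGb]; split; split => // x ax; apply: ab; [left|right].
  move=> a [fa aD]; apply: contrapT => nB; apply: noa; exists a; split => // b ab.
  by apply: contrapT => nGb; apply: nB; exists b.
have BI a : I a -> filter_from I B (B a) by exists a.
have [|b [_ clb]] := @tychonoff X (fun=> bool) (fun=> setT) (fun=> bool_compact)
  (filter_from I B) FB; first exact: filterS filterT.
have Db x : D x -> b x.
  move=> Dx.
  have Ix : I [set x] by split; [exact: finite_set1 | move=> _ ->].
  have [c [[xc _] cb]] := clb _ _ (BI _ Ix) (nbhs_coord b x).
  by rewrite -cb; exact: xc.
have I0 : I set0 by split.
have [c [[_ nGc] Gc]] := clb _ _ (BI _ I0)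
  (open_nbhs_nbhs (conj oG (DG _ Db))).
exact: nGc.
Qed.

End PowerSet.

(** * Separation by G_delta sets *)

Section CountableSeparation.
Context {T : topologicalType}.
Implicit Types (D N O : set T).

(** The intersection of [F] is a G_delta set between [D] and the complement of [N]. For fixed [D],
    the separated [N] form a sigma-ideal. *)
Definition Gdelta_separated D N := exists F : set (set T),
  [/\ countable F, forall O, F O -> open O /\ D `<=` O
    & forall t, N t -> exists2 O, F O & ~ O t].

Lemma Gdelta_separatedS {D N N'} : N `<=` N' ->
  Gdelta_separated D N' -> Gdelta_separated D N.
Proof. by move=> NN' [F [cF oF FN']]; exists F; split => // t /NN' /FN'. Qed.

Lemma Gdelta_separatedC {D O} : open O -> D `<=` O -> Gdelta_separated D (~` O).
Proof.
move=> oO DO; exists [set O]; split; first exact: countable1.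
  by move=> _ ->.
by move=> t nOt; exists O.
Qed.

Lemma Gdelta_separated_bigcup {I : Type} {K : set I} {D} {N : I -> set T} :
  countable K -> (forall i, K i -> Gdelta_separated D (N i)) ->
  Gdelta_separated D (\bigcup_(i in K) N i).
Proof.
move=> cK sepN.
have /choice[F FP] : forall i, exists F : set (set T), K i ->
    [/\ countable F, forall O, F O -> open O /\ D `<=` O
      & forall t, N i t -> exists2 O, F O & ~ O t].
  by move=> i; have [/sepN[F]|nK] := pselect (K i); [exists F|exists set0].
exists (\bigcup_(i in K) F i); split.
- by apply: bigcup_countable => // i /FP[].
- by move=> U [i /FP[_ oF _]]; exact: oF.
- move=> t [i Ki Nit]; have [_ _ /(_ _ Nit)[U FU nUt]] := FP _ Ki.
  by exists U => //; exists i.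
Qed.

Lemma Gdelta_separatedU {D N N'} : Gdelta_separated D N ->
  Gdelta_separated D N' -> Gdelta_separated D (N `|` N').
Proof.
move=> sN sN'; rewrite -bigcup2E.
apply: Gdelta_separated_bigcup => // -[|[|n]] _ //=.
by exists set0; split.
Qed.

Lemma Gdelta_separated_Gdelta D : Gdelta_separated D (~` D) -> Gdelta D.
Proof.
move=> [F [/pfcard_geP cF oF FD]].
have [G [oG DG]] : exists G : nat -> set T, (forall n, open (G n) /\ D `<=` G n) /\
    (forall t, ~ D t -> exists n, ~ G n t).
  case: cF => [F0|/surjfunPex[G GF]].
    exists (fun=> setT); split; first by split => //; exact: openT.
    by move=> t /FD[U]; rewrite F0.
  exists G; split => [n|t /FD[U]]; first by apply: oF; rewrite GF; exists n.
  by rewrite GF => -[n _ <-]; exists n.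
exists G; first by move=> n; have [] := oG n.
apply/seteqP; split => [t Dt n _|t Gt]; first by have [_] := oG n; apply.
by apply: contrapT => /DG[n]; apply; exact: Gt.
Qed.

End CountableSeparation.

(** * Small cells in a Polish space *)

Section PolishCells.
Context {R : realType} {P : topologicalType}.

(** The cells of level [n] are balls of radius 1/(n+1), for a complete metric, about points of a
    countable dense set. A sequence with tails in such balls is Cauchy. *)
Lemma polish_cells : polish_space R P ->
  exists (S : set P) (C : nat -> P -> set P),
    [/\ countable S, forall n y, exists2 q, S q & C n q y
      & forall q y : nat -> P, (forall n m, (n < m)%N -> C n (q n) (y m)) ->
          exists l : P, y @ \oo --> l].
Proof.
move=> [[S cS dS] [M [h [g [gh hg ch cg complM]]]]].
exists S, (fun n q => [set y | ball (h q) (n.+1%:R^-1)%R (h y)]); split => //.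
- move=> n y.
  have nby : nbhs y [set z | ball (h y) (n.+1%:R^-1)%R (h z)].
    by apply: (ch y); apply: nbhsx_ballx; rewrite invr_gt0 ltr0n.
  have [|//|q [+ Sq]] := dS ([set z | ball (h y) (n.+1%:R^-1)%R (h z)]°).
  + by exists y.
  + exact: open_interior.
  by move=> /interior_subset /ball_sym; exists q.
- move=> q y Cqy.
  have [l hyl] : exists l : M, h \o y @ \oo --> l.
    apply: complM; apply: cauchy_exP => e e0.
    have [N _ Ne] := near_infty_natSinv_lt (PosNum e0).
    exists (h (q N)); exists N.+1 => // m /= Nm.
    by apply: le_ball (Cqy _ _ Nm); exact/ltW/(Ne N)/leqnn.
  exists (g l); have -> : y = g \o (h \o y) by apply/funext => n /=; rewrite gh.
  by apply: cvg_comp hyl _; exact: cg.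
Qed.

End PolishCells.

Lemma Gdelta_II_wins (X : topologicalType) :
  Gdelta (in_pow2 (dense_sets X)) -> II_has_winning_strategy X.
Proof.
move=> [G oG denseG].
have /choice[t tP] : forall nD : nat * set X, exists a, dense nD.2 ->
    [/\ finite_set a, a `<=` nD.2 &
      forall b : {ptws X -> bool}, (forall x, a x -> b x) -> G nD.1 b].
  move=> [n D] /=; have [dD|nD] := pselect (dense D); last by exists set0.
  have [b Db|a aP] := @finite_part_in_open X (G n) D (oG n); last by exists a.
  suff : in_pow2 (dense_sets X) b by rewrite denseG; apply.
  rewrite in_pow2E => U U0 oU; apply: subset_nonempty (dD U U0 oU).
  by move=> x [Ux Dx]; split => //; exact: Db.
(* Of the past only the round number [size s] matters: the answer in round [n] puts the final union
   into [G n]. *)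
exists (fun s D => t (size s, D)); split => [s D dD|D dD].
  by have [] := tP (size s, D) dD.
rewrite /II_wins_run; set A := \bigcup_n _.
suff : in_pow2 (dense_sets X) (charfun A).
  rewrite in_pow2E /charfun.
  by rewrite (_ : [set x | x \in A] = A)//; apply/seteqP; split => x; rewrite /= inE.
rewrite denseG => n _; have [_ _] := tP (n, D n) (dD n); apply => x tx.
by rewrite /charfun inE; exists n => //; rewrite size_mkseq.
Qed.

(** * The unfolded game of player I *)

Section PlayerI.
Context {R : realType} {X P : topologicalType}.
Hypothesis X_countable : countable [set: X].
Hypothesis P_polish : polish_space R P.
Variable f : P -> {ptws X -> bool}.
Hypothesis f_continuous : continuous f.
Hypothesis f_open : forall y, open [set x | f y x].
Variable p : X.

Local Notation DX := (in_pow2 (dense_sets X)).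

(** [A] collects moves of player II, and [f y] is a candidate for the open set to be missed. Fixing
    [p] keeps the limit of the candidates nonempty. *)
Definition missing (V : set P) (A : set X) : set {ptws X -> bool} :=
  [set b : {ptws X -> bool} | (forall x, A x -> b x) /\
    exists y, [/\ V y, f y p & forall x, f y x -> ~~ b x]].

(* By contradiction: the b in [missing (V `&` C q) A] containing some finite a for
   which [missing (V `&` C q) (A `|` a)] is separated are handled by the countably
   many such a; the others avoid an open set, which contains all dense sets
   because otherwise a dense set outside it would be the required D. *)
Lemma missing_step (S : set P) (C : P -> set P) V A :
  countable S -> (forall y, exists2 q, S q & C q y) ->
  ~ Gdelta_separated DX (missing V A) ->
  exists q D, dense D /\ forall a, finite_set a -> a `<=` D ->
    ~ Gdelta_separated DX (missing (V `&` C q) (A `|` a)).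
Proof.
move=> cS SC nsep; apply: contrapT => noqD; apply: nsep.
have sepq q : S q -> Gdelta_separated DX (missing (V `&` C q) A).
  move=> Sq.
  pose K := [set a | finite_set a /\
    Gdelta_separated DX (missing (V `&` C q) (A `|` a))].
  pose O := \bigcup_(a in K) [set b : {ptws X -> bool} | forall x, a x -> b x].
  have oO : open O by apply: bigcup_open => a [fa _]; exact: open_supersets.
  have DO : DX `<=` O.
    move=> b; rewrite in_pow2E => db; apply: contrapT => nOb; apply: noqD.
    exists q, [set x | b x]; split => // a fa ab sepa.
    by apply: nOb; exists a => //; split.
  have cK : countable K.
    apply: sub_countable (countable_finite_subset X_countable).
    by apply: subset_card_le => a [fa _]; split.
  apply: Gdelta_separatedS (Gdelta_separatedU
    (@Gdelta_separated_bigcup _ _ K _ (fun a => missing (V `&` C q) (A `|` a)) cK _)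
    (Gdelta_separatedC oO DO)); last by move=> a [].
  move=> b [Ab yb]; have [[a Ka ab]|nOb] := pselect (O b); last by right.
  by left; exists a => //; split => // x [/Ab|/ab].
apply: Gdelta_separatedS (Gdelta_separated_bigcup cS sepq).
move=> b [Ab [y [Vy fp fb]]]; have [q Sq Cqy] := SC y.
by exists q => //; split => //; exists y.
Qed.

Lemma not_separated_I_wins :
  ~ Gdelta_separated DX (missing setT set0) -> I_has_winning_strategy X.
Proof.
move=> nsep0; have [S [C [cS SC limC]]] := polish_cells P_polish.
pose sep V A := Gdelta_separated DX (missing V A).
have /choice[g gP] : forall st : nat * set P * set X, exists qD : P * set X, dense qD.2 /\
    (~ sep st.1.2 st.2 -> forall a, finite_set a -> a `<=` qD.2 ->
      ~ sep (st.1.2 `&` C st.1.1 qD.1) (st.2 `|` a)).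
  move=> [[n V] A] /=; have [sVA|nsVA] := pselect (sep V A).
    (* The separated case never arises in play but needs a default value. If [P] were empty, so
       would be [missing], and the empty family would separate it. *)
    have [y _] : exists y : P, True.
      apply: contrapT => noP; apply: nsep0; exists set0; split => // b [_ [y]].
      by case: noP; exists y.
    exists (y, setT); split => // U U0 _; by rewrite setIT.
  have [q [D [dD qD]]] := missing_step S (C n) V A cS (SC n) nsVA.
  by exists (q, D).
pose step (st : nat * set P * set X) a :=
  (st.1.1.+1, st.1.2 `&` C st.1.1 (g st).1, st.2 `|` a).
pose state := foldl step (0%N, setT, set0).
exists (fun s => (g (state s)).2); split => [s|a aP]; first by have [] := gP (state s).
pose st n := state (mkseq a n).
have stS n : st n.+1 = step (st n) (a n) by rewrite /st /state mkseqS foldl_rcons.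
have st1 n : (st n).1.1 = n by elim: n => [//|n IH]; rewrite stS /= IH.
have nsep n : ~ sep (st n).1.2 (st n).2.
  elim: n => [//|n IH]; rewrite stS; have [fa ag] := aP n.
  by have [_ /(_ IH)] := gP (st n); apply.
(* An empty [missing] is separated by the empty family, so some candidate still avoids all moves
   played so far. *)
have /choice[y yP] : forall n, exists y,
    [/\ (st n).1.2 y, f y p & forall x, (st n).2 x -> ~~ f y x].
  move=> n; apply: contrapT => noy; apply: (nsep n); exists set0; split => //.
  move=> b [Ab [y [Vy fp fb]]]; case: noy; exists y; split => // x /Ab bx.
  by apply/negP => /fb /negP.
have stV n m : (n <= m)%N -> (st m).1.2 `<=` (st n).1.2.
  elim: m => [|m IH]; first by rewrite leqn0 => /eqP ->.
  rewrite leq_eqVlt => /orP[/eqP->//|/IH stm]; rewrite stS /=.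
  by move=> z [/stm].
have stA n m : (n <= m)%N -> (st n).2 `<=` (st m).2.
  elim: m => [|m IH]; first by rewrite leqn0 => /eqP ->.
  rewrite leq_eqVlt => /orP[/eqP->//|/IH stm]; rewrite stS /=.
  by move=> z /stm; left.
have [n m nm|l yl] := limC (fun n => (g (st n)).1) y.
  have [/(stV _ _ nm) + _ _] := yP m.
  by rewrite stS /= st1 => -[].
have fyl x : \forall n \near \oo, f (y n) x = f l x.
  have fyl : f \o y @ \oo --> f l by apply: cvg_comp yl _; exact: f_continuous.
  exact: fyl _ (nbhs_coord (f l) x).
move=> dense_a; have [||x [flx [k _ akx]]] := dense_a [set x | f l x].
- exists p => /=; have [n <-] := filter_ex (fyl p).
  by have [] := yP n.
- exact: f_open.
(* From [N] on, [x] belongs to [f (y m)]; from [k.+1] on, the state contains [a k], so that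
   [f (y m)] avoids [x]. *)
- have [N _ Nf] := fyl x; pose m := maxn N k.+1.
  have [_ _ /(_ x)] := yP m; rewrite (Nf m (leq_maxl _ _)) flx => mx.
  have : (st m).2 x by apply: (stA k.+1); [exact: leq_maxr|rewrite stS; right].
  by move/mx.
Qed.

End PlayerI.

Theorem theorem4p4 (R : realType) (X : topologicalType)
    (X_countable : countable [set: X])
    (X_regular : regular_space X)
    (X_T1 : accessible_space X)
    (X_no_isolated : isolated [set: X] = set0)
    (X_analytic : analytic R (in_pow2 (@open X))) :
  Gfin_determined X /\
  (Gdelta (in_pow2 (dense_sets X)) -> II_has_winning_strategy X) /\
  (~ Gdelta (in_pow2 (dense_sets X)) -> I_has_winning_strategy X).
Proof.
suff I_wins : ~ Gdelta (in_pow2 (dense_sets X)) -> I_has_winning_strategy X.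
  split; last by split => //; exact: Gdelta_II_wins.
  have [/Gdelta_II_wins|/I_wins] := pselect (Gdelta (in_pow2 (dense_sets X)));
    by [right|left].
move=> nGdelta; have [P [f [P_polish cf rf]]] := X_analytic.
have f_open y : open [set x | f y x].
  by have : range f (f y) by []; rewrite rf in_pow2E.
apply: contrapT => nI; apply/nGdelta/Gdelta_separated_Gdelta.
have sep p : Gdelta_separated (in_pow2 (dense_sets X)) (missing f p setT set0).
  by apply: contrapT => nsep; apply: nI;
    exact: (not_separated_I_wins X_countable P_polish f cf f_open p nsep).
(* A set that is not dense misses a nonempty open [U], which is some [f y]; it thus lies in
   [missing] for any [p] in [U]. *)
apply: Gdelta_separatedS (Gdelta_separated_bigcup X_countable (fun p _ => sep p)).
move=> b; rewrite /setC /= in_pow2E => /existsNP[U].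
move=> /not_implyP[[p Up]] /not_implyP[oU Ub].
have [y _ yU] : range f (charfun U) by rewrite rf; exists U.
exists p => //; split => //; exists y; rewrite yU /charfun; split=> // [|x].
  by rewrite inE.
by rewrite inE => Ux; apply/negP => bx; apply: Ub; exists x.
Qed.
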